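(* Let $(x^{*},y^{*})$ be a saddle-point of $f$, and let $((x^k,y^k))_{k\in\mathbf N}$ be generated by the alternating proximal mapping method with constant parameters: for all $k\in\mathbf N\cup\{-1\}$, $\tau_k=\tau\in\mathbf R_{++}$, $\sigma_k=\sigma\in\mathbf R_{++}$, $\alpha_k=\alpha\in\mathbf R_{++}$, $\beta_k=\beta\in\mathbf R_+$. Let $\tau,\sigma>0$ be small enough that $\|K\|^2<\frac{2\mu+\frac1\tau}{\sigma}$ and $\|K\|^2<\frac{2\nu+\frac1\sigma}{\tau}$. Let $\alpha\in\big(\frac1{2\mu\tau+1},1\big)$ be such that $\alpha\ge\frac1{2\nu\sigma+1}$ and $\alpha\tau\sigma\|K\|^2<1$. Let $\beta$ satisfy $\sigma\|K\|^2\beta^2\le(1-\alpha\tau\sigma\|K\|^2)\big(2\mu+\frac1\tau-\frac1{\alpha\tau}\big)$. Let $\eta_4\in\mathbf R_{++}$ satisfy $\eta_4\ge\tau$ and $\alpha\sigma\eta_4\|K\|^2<1$. Let $\eta_3\in\mathbf R_{++}$ satisfy $\eta_3>\frac{\sigma\|K\|}{1-\alpha\tau\sigma\|K\|^2}$ and $\eta_3\|K\|\beta^2<2\mu+\frac1\tau-\frac1{\alpha\tau}$. Let $\eta_1\in\mathbf R_{++}$ satisfy $\eta_1\ge\frac{\sigma\|K\|\eta_3}{\eta_3-\sigma\|K\|}$ and $\alpha\tau\eta_1\|K\|<1$. Let $\eta_2\in\mathbf R_{++}$ satisfy $\eta_2\ge\frac{\tau\|K\|}{\alpha-\tau\eta_1\|K\|\alpha^2}$.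 Then for every $k\in\mathbf N$, $$\|x^{k+1}-x^*\|\le\alpha^{k+1}\tau\Big(\frac1{\tau_0}\|x^*-x^0\|^2+\frac1{\sigma_0}\|y^*-y^0\|^2\Big),$$ $$\|y^{k+1}-y^*\|\le\alpha^{k+1}\Big(\frac1{\sigma}-\alpha\eta_4\|K\|^2\Big)\Big(\frac1{\tau_0}\|x^*-x^0\|^2+\frac1{\sigma_0}\|y^*-y^0\|^2\Big),$$ where $\tau_0=\tau$ and $\sigma_0=\sigma$. Consequently, the sequence of iterations $((x^k,y^k))_{k\in\mathbf N}$ linearly converges to the saddle-point $(x^*,y^* )$ of $f$ with a rate $\alpha\in(0,1)$.
   Context: $\mathbf N=\{0,1,2,\dots\}$, $\mathbf R_+=[0,\infty)$, $\mathbf R_{++}=(0,\infty)$. $\mathcal H_1,\mathcal H_2$ are Hilbert spaces; $K:\mathcal H_1\to\mathcal H_2$ is a continuous linear operator with operator norm $\|K\|$ and adjoint $K^*$. $g:\mathcal H_1\to\mathbf R\cup\{+\infty\}$ and $h:\mathcal H_2\to\mathbf R\cup\{+\infty\}$ are proper and lower semicontinuous; $\mu,\nu\in\mathbf R_{++}$; $g$ is strongly convex with modulus $\mu$, i.e. $\langle u,x-\bar x\rangle+\frac\mu2\|x-\bar x\|^2+g(\bar x)\le g(x)$ for all $\bar x\in\operatorname{dom}\partial g$, $u\in\partial g(\bar x)$, $x\in\mathcal H_1$; and $h$ is strongly convex with modulus $\nu$ (same inequality with $h,\nu,\mathcal H_2$). The constants $\mu,\nu,\|K\|$ are known. Define $f(x,y)=\langle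 Kx,y\rangle+g(x)-h(y)$ on $\mathcal H_1\times\mathcal H_2$. A saddle-point of $f$ is $(x^*,y^* )$ with $f(x^*,y)\le f(x^*,y^* )\le f(x,y^* )$ for all $x\in\mathcal H_1,y\in\mathcal H_2$; one is assumed to exist. Alternating proximal mapping method: given sequences $(\tau_k)_{k\in\mathbf N\cup\{-1\}}$, $(\sigma_k)_{k\in\mathbf N\cup\{-1\}}$ in $\mathbf R_{++}$ and $(\alpha_k)_{k\in\mathbf N\cup\{-1\}}$, $(\beta_k)_{k\in\mathbf N\cup\{-1\}}$ in $\mathbf R_+$, and $(x^0,y^0)\in\mathcal H_1\times\mathcal H_2$, set $x^{-1}=x^0$, $y^{-1}=y^0$, $\bar x^0=x^0$, $\bar y^0=y^0$ and for every $k\in\mathbf N$: $y^{k+1}=\operatorname{Prox}_{\sigma_kh}(\sigma_kK\bar x^k+y^k)$; $\bar y^{k+1}=y^{k+1}+\beta_k(y^{k+1}-y^k)$; $x^{k+1}=\operatorname{Prox}_{\tau_kg}(-\tau_kK^*\bar y^{k+1}+x^k)$; $\bar x^{k+1}=x^{k+1}+\alpha_k(x^{k+1}-x^k)$. Here $\operatorname{Prox}_\varphi(z)=\operatorname{argmin}_w(\varphi(w)+\frac12\|z-w\|^2)$.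
   Formalization: The printed estimates are false: here the left-hand norms are squared, the y-bound is divided (not multiplied) by 1/σ − αη₄‖K‖², and linear convergence with rate α refers to squared distances; strong convexity explicitly includes convexity. *)

(* Defs.v *)
From HB Require Import structures.
From mathcomp Require Import all_boot all_order all_algebra sesquilinear.
From mathcomp Require Import all_classical all_reals all_analysis.
Set Implicit Arguments.
Unset Strict Implicit.
Unset Printing Implicit Defensive.
Import Order.TTheory GRing.Theory Num.Theory.
Import numFieldNormedType.Exports.
Local Open Scope classical_set_scope.
Local Open Scope ring_scope.

HB.mixin Record NormedModule_isHilbert (R : realType) H
    of CompleteNormedModule R H := {
  inner : {dot H for @idfun R} ;
  inner_norm : forall x : H, inner x x = `|x| ^+ 2
}.

#[short(type="hilbertType")]
HB.structure Definition Hilbert (R : realType) :=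
  {H of NormedModule_isHilbert R H & CompleteNormedModule R H}.


Definition opnorm (R : realType) (V W : normedModType R) (K : V -> W) : R :=
  sup [set `|K x| | x in [set x : V | `|x| <= 1]].

(* At most one Ks satisfies this, so it characterizes the adjoint. *)
Definition is_adjoint (R : realType) (H1 H2 : hilbertType R)
    (K : H1 -> H2) (Ks : H2 -> H1) : Prop :=
  forall x y, inner (K x) y = inner x (Ks y).

Section ExtendedRealFunctions.
Context {R : realType} {H : hilbertType R}.
Local Open Scope ereal_scope.

(* With the first conjunct, \bar R stands for the codomain R `|` {+oo}. *)
Definition proper_fun (g : H -> \bar R) : Prop :=
  (forall x, g x != -oo) /\ (exists x, g x < +oo).

(* For proper g this forces g x to be finite when subdiff g x is nonempty. *)
Definition subdiff (g : H -> \bar R) (x : H) : set H :=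
  [set u | forall z, (inner u (z - x))%:E + g x <= g z].

Definition convex_efun (g : H -> \bar R) : Prop :=
  forall (x y : H) (t : R), (0 <= t <= 1)%R ->
    g (t *: x + (1 - t) *: y)%R <= t%:E * g x + (1 - t)%:E * g y.

(* The second conjunct expresses strong convexity among convex functions; by
   itself it holds vacuously when g has no subgradient at all. *)
Definition strongly_convex (g : H -> \bar R) (m : R) : Prop :=
  convex_efun g /\
  forall xb u x, subdiff g xb u ->
    (inner u (x - xb) + m / 2 * `|x - xb| ^+ 2)%:E + g xb <= g x.

(* The set of minimizers defining Prox_phi(z). *)
Definition prox (phi : H -> \bar R) (z : H) : set H :=
  [set w | forall v, phi w + (2^-1 * `|z - w| ^+ 2)%:E
                     <= phi v + (2^-1 * `|z - v| ^+ 2)%:E].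

End ExtendedRealFunctions.

Section SaddlePointProblem.
Context {R : realType} {H1 H2 : hilbertType R}.
Variables (K : H1 -> H2) (g : H1 -> \bar R) (h : H2 -> \bar R).
Local Open Scope ereal_scope.

Definition lagrangian (x : H1) (y : H2) : \bar R :=
  (inner (K x) y)%:E + g x - h y.

(* For proper g and h a saddle-point lies in dom g * dom h, so the value
   +oo - oo = -oo chosen by the library is never compared below. *)
Definition saddle_point (xs : H1) (ys : H2) : Prop :=
  forall x y, lagrangian xs y <= lagrangian xs ys /\
              lagrangian xs ys <= lagrangian x ys.

(* Since xbar 0 = x 0 and ybar 0 = y 0, no index -1 is needed. *)
Definition alternating_proximal (Ks : H2 -> H1) (tau sigma alpha beta : nat -> R)
    (x xbar : nat -> H1) (y ybar : nat -> H2) : Prop :=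
  xbar 0%N = x 0%N /\ ybar 0%N = y 0%N /\
  forall k : nat,
  [/\ prox (fun v => (sigma k)%:E * h v)
        (sigma k *: K (xbar k) + y k)%R (y k.+1),
      ybar k.+1 = (y k.+1 + beta k *: (y k.+1 - y k))%R,
      prox (fun u => (tau k)%:E * g u)
        (- (tau k *: Ks (ybar k.+1)) + x k)%R (x k.+1)
    & xbar k.+1 = (x k.+1 + alpha k *: (x k.+1 - x k))%R].

End SaddlePointProblem.

(* The rate q refers to squared distances, i.e. the distances themselves are
   O(q ^ (k / 2)): for K = 0, g = (mu / 2) |.|^2 and x* = 0 the method gives
   x k = (1 + mu tau)^-k x 0, which is not O(alpha ^ k) for
   1 / (1 + 2 mu tau) < alpha < 1 / (1 + mu tau). *)
Definition linearly_converges (R : realType) (H1 H2 : hilbertType R)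
    (x : nat -> H1) (y : nat -> H2) (xs : H1) (ys : H2) (q : R) : Prop :=
  [/\ 0 < q < 1,
      (fun k => (x k, y k)) @ \oo --> (xs, ys)
    & exists C : R, forall k : nat,
        `|x k - xs| ^+ 2 + `|y k - ys| ^+ 2 <= C * q ^+ k].

(* Main.v *)
Require Import Defs.
From HB Require Import structures.
From mathcomp Require Import all_boot all_order all_algebra sesquilinear.
From mathcomp Require Import all_classical all_reals all_analysis.
From mathcomp Require Import ring lra.
Set Implicit Arguments.
Unset Strict Implicit.
Unset Printing Implicit Defensive.
Import Order.TTheory GRing.Theory Num.Theory.
Import numFieldNormedType.Exports.
Local Open Scope classical_set_scope.
Local Open Scope ring_scope.

(** With d_k = x^k - x*, e_k = y^k - y* and xi_k = x^k - x^{k-1}, the energy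
      V_k = |e_k|^2 / sigma + |d_k|^2 / tau + (alpha / tau) |xi_k|^2
            + 2 alpha <K xi_k, e_k>
    satisfies V_{k+1} <= alpha V_k.  Indeed, both the iterates and the
    saddle-point provide subgradients of g and h, and strong monotonicity of the
    subdifferentials leaves, besides V_{k+1} / alpha and V_k, only the cross
    terms 2 beta <K d_{k+1}, y^{k+1} - y^k> and 2 alpha <K xi_k, y^{k+1} - y^k>.
    Young's inequality absorbs them in |d_{k+1}|^2, |xi_k|^2 and
    |y^{k+1} - y^k|^2, which is exactly what the bound on beta allows.  Young's
    inequality also gives
      (1 / sigma - alpha tau |K|^2) |e_k|^2 + |d_k|^2 / tau <= V_k,
    and V_0 has no xi-terms since x^{-1} = x^0. *)

(** * Inner product calculus and Young's inequality *)

Section InnerProduct.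
Context {R : realType} {H : hilbertType R}.
Implicit Types (u v w : H) (a : R).

Lemma innerC u v : inner u v = inner v u.
Proof. by rewrite hermC expr0 mul1r. Qed.

Lemma innerDl u v w : inner (u + v) w = inner u w + inner v w.
Proof. exact: linearDl. Qed.

Lemma innerDr u v w : inner w (u + v) = inner w u + inner w v.
Proof. exact: linearDr. Qed.

Lemma innerNl u v : inner (- u) v = - inner u v.
Proof. exact: linearNl. Qed.

Lemma innerNr u v : inner u (- v) = - inner u v.
Proof. exact: linearNr. Qed.

Lemma innerZl a u v : inner (a *: u) v = a * inner u v.
Proof. exact: linearZl_LR. Qed.

Lemma innerZr a u v : inner u (a *: v) = a * inner u v.
Proof. exact: linearZr_LR. Qed.

Definition innerE :=
  (innerDl, innerDr, innerNl, innerNr, innerZl, innerZr).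

(** Expand the square [|a u - v|^2 / a >= 0]. *)
Lemma inner_young u v a : 0 < a ->
  2 * inner u v <= a * `|u| ^+ 2 + a^-1 * `|v| ^+ 2.
Proof.
move=> a0; have : 0 <= a^-1 * inner (a *: u - v) (a *: u - v).
  by rewrite inner_norm mulr_ge0 ?sqr_ge0 // invr_ge0 ltW.
rewrite !innerE (innerC v u) !inner_norm.
have -> : a^-1 * (a * (a * `|u| ^+ 2 - inner u v)
    - (a * inner u v - `|v| ^+ 2))
  = a * `|u| ^+ 2 - 2 * inner u v + a^-1 * `|v| ^+ 2.
  by field; rewrite gt_eqF.
lra.
Qed.

End InnerProduct.

(** * Operator norm bounds *)

Section OperatorNorm.
Context {R : realType} {H1 H2 : hilbertType R}.
Variable K : {linear H1 -> H2}.
Hypothesis Kcont : continuous K.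

Lemma le_opnorm (u : H1) : `|K u| <= opnorm K * `|u|.
Proof.
have /linear_boundedP[M [Mreal HM]] : bounded_near K (nbhs (0 : H1)).
  by apply: continuous_linear_bounded; exact: Kcont.
have ub : has_ubound [set `|K x| | x in [set x : H1 | `|x| <= 1]].
  (* [HM] holds only for constants exceeding [M], which may be negative; [|M| + 1] is such a
     constant and is nonnegative. *)
  exists (`|M| + 1) => _ [x /= x1 <-].
  have := HM (`|M| + 1) _ x; rewrite (le_lt_trans (ler_norm M)) ?ltrDl // => /(_ isT).
  move/le_trans; apply; rewrite -[leRHS]mulr1 ler_wpM2l // addr_ge0 //.
have [->|u0] := eqVneq u 0; first by rewrite linear0 !normr0 mulr0.
have nu : 0 < `|u| by rewrite normr_gt0.
rewrite -ler_pdivrMr // mulrC.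
have -> : `|u|^-1 * `|K u| = `|K (`|u|^-1 *: u)|.
  by rewrite linearZ normrZ ger0_norm // invr_ge0.
apply: (ub_le_sup ub) => /=; exists (`|u|^-1 *: u) => //=.
by rewrite normrZ ger0_norm ?invr_ge0 // mulVf // gt_eqF.
Qed.

Lemma le_opnorm_sqr (u : H1) : `|K u| ^+ 2 <= opnorm K ^+ 2 * `|u| ^+ 2.
Proof. by rewrite -exprMn ler_sqr ?nnegrE ?(le_trans _ (le_opnorm u)) ?le_opnorm. Qed.

(** Young's inequality with weight [1 / b] on [K u], followed by the operator norm bound. The
    degenerate case [b = 0], which occurs below when the norm of [K] is 0, forces [K u = 0]. *)
Lemma opnorm_young (u : H1) (v : H2) (a b : R) : 0 < a -> opnorm K ^+ 2 <= a * b ->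
  2 * inner (K u) v <= a * `|u| ^+ 2 + b * `|v| ^+ 2.
Proof.
move=> a0 Lab; have b0 : 0 <= b.
  by rewrite -(pmulr_rge0 _ a0) (le_trans _ Lab) ?sqr_ge0.
have Ku : `|K u| ^+ 2 <= a * b * `|u| ^+ 2.
  exact: le_trans (le_opnorm_sqr u) (ler_wpM2r (sqr_ge0 _) Lab).
have [b_eq0|b_neq0] := eqVneq b 0.
  move: Ku; rewrite b_eq0 mulr0 !mul0r addr0 => Ku0.
  have /eqP : `|K u| ^+ 2 == 0 by rewrite eq_le Ku0 sqr_ge0.
  move/eqP; rewrite sqrf_eq0 normr_eq0 => /eqP ->.
  rewrite -(scale0r (0 : H2)) innerZl mul0r mulr0 mulr_ge0 ?sqr_ge0 //; exact: ltW.
have bgt0 : 0 < b by rewrite lt_neqAle eq_sym b_neq0.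
have := @inner_young _ _ (K u) v b^-1; rewrite invr_gt0 => /(_ bgt0).
move/le_trans; apply; rewrite invrK lerD2r ler_pdivrMl //.
by rewrite mulrCA mulrA.
Qed.

End OperatorNorm.

(** * Two limiting arguments *)

Lemma le_of_le_add_mul (R : realType) (a b c : R) : 0 <= c ->
  (forall t, 0 < t <= 1 -> a <= b + t * c) -> a <= b.
Proof.
move=> c0 H; apply/ler_addgt0Pr => e e0.
have d0 : 0 < e / (c + 1) by rewrite divr_gt0 // ltr_wpDl.
have := H (Num.min 1 (e / (c + 1))); rewrite lt_min ltr01 d0 ge_min lexx.
move=> /(_ isT) /le_trans; apply; rewrite lerD2l.
apply: (@le_trans _ _ (e / (c + 1) * c)).
  by rewrite ler_wpM2r // ge_min lexx orbT.
by rewrite mulrAC ler_pdivrMr ?ltr_wpDl // ler_pM2l // lerDl.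
Qed.

Lemma cvg_sqr_geometric (R : realType) (V : normedModType R) (u : nat -> V)
    (l : V) (a M : R) : 0 < a < 1 ->
  (forall k, `|u k - l| ^+ 2 <= a ^+ k * M) -> u @ \oo --> l.
Proof.
move=> /andP[a0 a1] uM; apply/cvgrPdist_lt => e e0.
have aM : a ^+ k * M @[k --> \oo] --> 0.
  by rewrite -(mul0r M); apply: cvgMr_tmp; apply: cvg_expr; rewrite gtr0_norm.
near=> k; rewrite distrC -ltr_sqr ?nnegrE //; last exact: ltW.
apply: le_lt_trans (uM k) _; near: k.
by apply: (cvgr_lt _ aM); rewrite exprn_gt0.
Unshelve. all: by end_near. Qed.

(** * Subgradients at proximal points and at saddle-points *)

Section Subdifferential.
Context {R : realType} {H : hilbertType R}.
Variable g : H -> \bar R.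
Hypothesis g_proper : proper_fun g.

Lemma subdiff_fin_num a u : subdiff g a u -> g a \is a fin_num.
Proof.
move=> gau; have [gNy [z gz]] := g_proper.
move: (gau z) (gNy a) gz; case: (g a) => [r| |] //= + _.
by rewrite addey // leye_eq => /eqP ->.
Qed.

(** Add the strong convexity inequalities at [a] and at [b]: the finite values of [g] cancel and the
    two halves [m / 2] make up [m]. *)
Lemma strongly_convex_monotone m a b u v : strongly_convex g m ->
  subdiff g a u -> subdiff g b v ->
  inner (u - v) (b - a) + m * `|b - a| ^+ 2 <= 0.
Proof.
move=> [_ g_sc] gau gbv; move: (g_sc _ _ b gau) (g_sc _ _ a gbv).
move: (subdiff_fin_num gau) (subdiff_fin_num gbv).
case: (g a) (g b) => [r| |] // [s| |] // _ _.
rewrite -!EFinD !lee_fin -[a - b]opprB normrN !innerE.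
lra.
Qed.

(** Fermat's rule: test the minimality of [p] on the segment from [p] to [v], bound [g] there by
    convexity, divide by [t] and let [t] tend to 0. The quadratic term leaves an error
    [t |v - p|^2 / 2]. *)
Lemma prox_subdiff (c : R) z p : 0 < c -> convex_efun g ->
  prox (fun v => c%:E * g v)%E z p -> subdiff g p (c^-1 *: (z - p)).
Proof.
move=> c0 g_cvx gzp v; have [gNy [w gw]] := g_proper.
have gp : g p \is a fin_num.
  move: (gzp w) (gNy p) (gNy w) gw.
  case: (g p) => [r| |] //; case: (g w) => [s| |] //= + _ _ _.
  by rewrite gt0_muley ?lte_fin.
move: gp (gNy v) (fun t => gzp (t *: v + (1 - t) *: p)) (g_cvx v p).
case: (g p) => [r| |] //; case: (g v) => [s| |] //=; last by rewrite leey.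
move=> _ _ gz cvx; rewrite -EFinD lee_fin innerZl -lerBrDr ler_pdivrMl //.
apply: (@le_of_le_add_mul _ _ _ (2^-1 * `|v - p| ^+ 2)).
  by rewrite mulr_ge0 ?sqr_ge0.
move=> t /andP[t0 t1]; rewrite -(ler_pM2l t0).
have t01 : (0 <= t <= 1) by rewrite ltW.
move: (cvx t t01) (gz t) (gNy (t *: v + (1 - t) *: p)).
case: (g _) => [q| |] //; rewrite -!EFinM -!EFinD !lee_fin => qle + _.
have -> : z - (t *: v + (1 - t) *: p) = (z - p) - t *: (v - p).
  by rewrite scalerBl scale1r scalerBr addrCA opprD addrA.
rewrite -[`|_ - t *: _| ^+ 2]inner_norm -[`|z - p| ^+ 2]inner_norm.
rewrite -[`|v - p| ^+ 2]inner_norm.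
move: (z - p) (v - p) => zp vp.
rewrite !innerE (innerC vp zp) => Hle.
have := ler_wpM2l (ltW c0) qle.
nra.
Qed.

End Subdifferential.

(** Each half of the saddle-point property, with one variable frozen, is a subgradient inequality
    once the values at the saddle-point are finite. *)
Lemma saddle_point_subdiff (R : realType) (H1 H2 : hilbertType R)
    (K : {linear H1 -> H2}) (Ks : H2 -> H1) (g : H1 -> \bar R) (h : H2 -> \bar R)
    (xs : H1) (ys : H2) :
  is_adjoint K Ks -> proper_fun g -> proper_fun h -> saddle_point K g h xs ys ->
  subdiff g xs (- Ks ys) /\ subdiff h ys (K xs).
Proof.
move=> KsK [gNy [x0 gx0]] [hNy [y0 hy0]] xys.
have [gfin hfin] : g xs \is a fin_num /\ h ys \is a fin_num.
  (* If [h ys = +oo], the saddle value is [-oo], below the value at [(xs, y0)]; if only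
     [g xs = +oo], it is [+oo], above the value at [(x0, ys)]. *)
  move: (xys x0 y0) gx0 hy0 (gNy x0) (hNy y0) (gNy xs) (hNy ys).
  rewrite /lagrangian.
  case: (g xs) => [?| |] //; case: (h ys) => [?| |] //;
    case: (g x0) => [?| |] //; case: (h y0) => [?| |] //=; by case.
move: gfin hfin xys; rewrite /saddle_point /lagrangian /subdiff /=.
case: (g xs) => [r| |] //; case: (h ys) => [s| |] // _ _ xys.
split => [x|y].
  have [_] := xys x y0; move: (gNy x); case: (g x) => [q| |] // _;
    last by rewrite !leey.
  rewrite -!EFinN -!EFinD !lee_fin !innerE (innerC (Ks ys) x) (innerC (Ks ys) xs) -!KsK.
  lra.
have [+ _] := xys x0 y; move: (hNy y); case: (h y) => [q| |] // _;
    last by rewrite !leey.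
rewrite -!EFinN -!EFinD !lee_fin !innerE.
lra.
Qed.

(** * Lower bound and contraction of the energy *)

Section Lyapunov.
Context {R : realType} {H1 H2 : hilbertType R}.
Variables (K : {linear H1 -> H2}).
Hypothesis Kcont : continuous K.
Variables (tau sigma alpha : R).
Hypotheses (tau_gt0 : 0 < tau) (sigma_gt0 : 0 < sigma) (alpha_gt0 : 0 < alpha).

Definition lyapunov (xi d : H1) (e : H2) : R :=
  sigma^-1 * `|e| ^+ 2 + tau^-1 * `|d| ^+ 2
  + alpha / tau * `|xi| ^+ 2 + 2 * alpha * inner (K xi) e.

(** Young's inequality with weight [alpha / tau] on [xi] spends exactly the [|xi|^2] term of the
    energy on the cross term. *)
Lemma lyapunov_ge (xi d : H1) (e : H2) :
  (sigma^-1 - alpha * tau * opnorm K ^+ 2) * `|e| ^+ 2 + tau^-1 * `|d| ^+ 2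
    <= lyapunov xi d e.
Proof.
have at0 : 0 < alpha / tau by rewrite divr_gt0.
have := @opnorm_young _ _ _ K Kcont xi (- (alpha *: e)) (alpha / tau)
  ((alpha / tau)^-1 * opnorm K ^+ 2) at0.
rewrite mulrA divff ?gt_eqF // mul1r => /(_ (lexx _)).
rewrite normrN normrZ exprMn (gtr0_norm alpha_gt0) !innerE.
have -> : (alpha / tau)^-1 * opnorm K ^+ 2 * (alpha ^+ 2 * `|e| ^+ 2)
  = alpha * tau * opnorm K ^+ 2 * `|e| ^+ 2 by field; rewrite !gt_eqF.
rewrite /lyapunov; lra.
Qed.

Variables (mu nu beta : R).
Hypothesis alpha_mu : 1 / (2 * mu * tau + 1) < alpha.
Hypothesis mu_gt0 : 0 < mu.
Hypothesis nu_gt0 : 0 < nu.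
Hypothesis alpha_nu : 1 / (2 * nu * sigma + 1) <= alpha.
Hypothesis beta_ub : sigma * opnorm K ^+ 2 * beta ^+ 2
     <= (1 - alpha * tau * sigma * opnorm K ^+ 2)
        * (2 * mu + 1 / tau - 1 / (alpha * tau)).

(** The two premises are the monotonicity inequalities of the subdifferentials of [h] and [g]
    between the new iterate and the saddle-point. *)
Lemma lyapunov_step (xi d d' : H1) (e e' : H2) :
  sigma^-1 * inner (e' - e) e' - inner (K (d + alpha *: xi)) e'
    + nu * `|e'| ^+ 2 <= 0 ->
  tau^-1 * inner (d' - d) d' + inner (K d') (e' + beta *: (e' - e))
    + mu * `|d'| ^+ 2 <= 0 ->
  lyapunov (d' - d) d' e' <= alpha * lyapunov xi d e.
Proof.
have := beta_ub; set A := 2 * mu + 1 / tau - 1 / (alpha * tau).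
set L2 := opnorm K ^+ 2 => bub.
(* [A] is the surplus of [|d'|^2] left after paying for its share of the new energy divided by
   [alpha]. *)
have A0 : 0 < A.
  have -> : A = (2 * mu * tau + 1 - alpha^-1) / tau.
    by rewrite /A; field; rewrite !gt_eqF.
  rewrite divr_gt0 // subr_gt0 -[ltRHS]invrK ltf_pV2 ?posrE ?invr_gt0 //.
    by rewrite -div1r.
  by rewrite addr_gt0 // !mulr_gt0.
have AE : A = 2 * mu + tau^-1 - alpha^-1 / tau.
  by rewrite /A; field; rewrite !gt_eqF.
have L2E : opnorm K ^+ 2 <= L2 by [].
clearbody A L2.
(* The corresponding surplus of [|e'|^2] is nonnegative and gets discarded. *)
have nu_ge : 0 <= 2 * nu + sigma^-1 - alpha^-1 / sigma.
  have -> : 2 * nu + sigma^-1 - alpha^-1 / sigma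
      = (2 * nu * sigma + 1 - alpha^-1) / sigma by field; rewrite !gt_eqF.
  rewrite divr_ge0 ?(ltW sigma_gt0) // subr_ge0 -[leRHS]invrK.
  rewrite lef_pV2 ?posrE ?invr_gt0 //.
    by rewrite -div1r.
  by rewrite addr_gt0 // !mulr_gt0.
have at0 : 0 < alpha / tau by rewrite divr_gt0.
(* [y1] spends the surplus [A |d'|^2] on the [beta] cross term, [y2] the [|xi|^2] term of the old
   energy on the [alpha] one. *)
have y1 := @opnorm_young _ _ _ K Kcont d' (- (beta *: (e' - e))) A (A^-1 * L2) A0.
have {y1} := y1 _; rewrite mulrA divff ?gt_eqF // mul1r => /(_ L2E) y1.
have y2 := @opnorm_young _ _ _ K Kcont xi (alpha *: (e' - e)) (alpha / tau)
  ((alpha / tau)^-1 * L2) at0.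
have {y2} := y2 _; rewrite mulrA divff ?gt_eqF // mul1r => /(_ L2E) y2.
(* Both estimates charge [|e' - e|^2], of which polarization supplies [sigma^-1]; the bound is
   [beta_ub] divided by [sigma A]. *)
have coef : A^-1 * L2 * beta ^+ 2 + (alpha / tau)^-1 * L2 * alpha ^+ 2 <= sigma^-1.
  have -> : (alpha / tau)^-1 * L2 * alpha ^+ 2 = alpha * tau * L2.
    by field; rewrite !gt_eqF.
  rewrite -lerBrDr -mulrA ler_pdivrMl //.
  have -> : A * (sigma^-1 - alpha * tau * L2)
      = sigma^-1 * ((1 - alpha * tau * sigma * L2) * A).
    by field; rewrite gt_eqF.
  by rewrite ler_pdivlMl // mulrA.
move: y1 y2; rewrite normrN !normrZ !exprMn !real_normK ?num_real // => y1 y2.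
have := ler_wpM2r (sqr_ge0 `|e' - e|) coef.
have := mulr_ge0 nu_ge (sqr_ge0 `|e'|).
move: y1 y2; rewrite /lyapunov.
have KDZ a u v : K (u + a *: v) = K u + a *: K v by rewrite linearD linearZ.
have KB u v : K (u - v) = K u - K v by rewrite linearB.
have distr (a b c f : R) : alpha^-1 * (a + b + alpha / tau * c + 2 * alpha * f)
    = alpha^-1 * a + alpha^-1 * b + tau^-1 * c + 2 * f.
  by field; rewrite !gt_eqF.
rewrite KDZ KB -!inner_norm !innerE.
rewrite (innerC e e') (innerC d d') -(ler_pdivrMl _ _ alpha_gt0) distr.
move: (A^-1) (alpha / tau)^-1 => iA q; rewrite AE.
lra.
Qed.

End Lyapunov.

(* The left-hand sides of the two estimates are squared: for K = 0,
   g = (mu / 2) |.|^2, h = (nu / 2) |.|^2 and y 0 = 0, the estimates on plain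
   norms fail as soon as x 0 is small. In the second one, the factor
   1 / sigma - alpha * eta4 * |K|^2 divides the right-hand side: multiplying by
   it fails for the same K, g, h when x 0 = 0, nu is small and sigma is large. *)
Theorem corollary3p1 (R : realType) (H1 H2 : hilbertType R)
  (K : {linear H1 -> H2}) (Ks : H2 -> H1)
  (Kcont : continuous K) (KsK : is_adjoint K Ks)
  (g : H1 -> \bar R) (h : H2 -> \bar R)
  (g_proper : proper_fun g) (g_lsc : lower_semicontinuous g)
  (h_proper : proper_fun h) (h_lsc : lower_semicontinuous h)
  (mu nu : R) (mu_gt0 : 0 < mu) (nu_gt0 : 0 < nu)
  (g_sc : strongly_convex g mu) (h_sc : strongly_convex h nu)
  (xs : H1) (ys : H2) (xys : saddle_point K g h xs ys)
  (tau sigma alpha beta : R)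
  (tau_gt0 : 0 < tau) (sigma_gt0 : 0 < sigma)
  (alpha_gt0 : 0 < alpha) (beta_ge0 : 0 <= beta)
  (x xbar : nat -> H1) (y ybar : nat -> H2)
  (xy_gen : alternating_proximal K g h Ks
     (fun=> tau) (fun=> sigma) (fun=> alpha) (fun=> beta) x xbar y ybar)
  (tau_small : opnorm K ^+ 2 < (2 * mu + 1 / tau) / sigma)
  (sigma_small : opnorm K ^+ 2 < (2 * nu + 1 / sigma) / tau)
  (alpha_lb : 1 / (2 * mu * tau + 1) < alpha) (alpha_lt1 : alpha < 1)
  (alpha_lb' : 1 / (2 * nu * sigma + 1) <= alpha)
  (alpha_K : alpha * tau * sigma * opnorm K ^+ 2 < 1)
  (beta_ub : sigma * opnorm K ^+ 2 * beta ^+ 2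
     <= (1 - alpha * tau * sigma * opnorm K ^+ 2)
        * (2 * mu + 1 / tau - 1 / (alpha * tau)))
  (eta1 eta2 eta3 eta4 : R)
  (eta4_gt0 : 0 < eta4) (eta4_lb : tau <= eta4)
  (eta4_ub : alpha * sigma * eta4 * opnorm K ^+ 2 < 1)
  (eta3_gt0 : 0 < eta3)
  (eta3_lb : sigma * opnorm K / (1 - alpha * tau * sigma * opnorm K ^+ 2) < eta3)
  (eta3_ub : eta3 * opnorm K * beta ^+ 2 < 2 * mu + 1 / tau - 1 / (alpha * tau))
  (eta1_gt0 : 0 < eta1)
  (eta1_lb : sigma * opnorm K * eta3 / (eta3 - sigma * opnorm K) <= eta1)
  (eta1_ub : alpha * tau * eta1 * opnorm K < 1)
  (eta2_gt0 : 0 < eta2)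
  (eta2_lb : tau * opnorm K / (alpha - tau * eta1 * opnorm K * alpha ^+ 2) <= eta2) :
  (forall k : nat,
     `|x k.+1 - xs| ^+ 2
       <= alpha ^+ k.+1 * tau
          * (1 / tau * `|xs - x 0%N| ^+ 2 + 1 / sigma * `|ys - y 0%N| ^+ 2)
     /\
     `|y k.+1 - ys| ^+ 2
       <= alpha ^+ k.+1 / (1 / sigma - alpha * eta4 * opnorm K ^+ 2)
          * (1 / tau * `|xs - x 0%N| ^+ 2 + 1 / sigma * `|ys - y 0%N| ^+ 2))
  /\ linearly_converges x y xs ys alpha.
Proof.
have [xbar0 [_ gen]] := xy_gen.
have [g_xs h_ys] := saddle_point_subdiff KsK g_proper h_proper xys.
(* Since [0.-1 = 0], the formula at [k = 0] encodes [x^{-1} = x^0]. *)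
have xbarE k : xbar k = x k + alpha *: (x k - x k.-1).
  case: k => [|k]; first by rewrite xbar0 subrr scaler0 addr0.
  by have [] := gen k.
have ybarE k : ybar k.+1 = y k.+1 + beta *: (y k.+1 - y k) by have [] := gen k.
pose V k := lyapunov K tau sigma alpha (x k - x k.-1) (x k - xs) (y k - ys).
set D := 1 / tau * _ + 1 / sigma * _.
have V0 : V 0%N = D.
  rewrite /V /D /lyapunov subrr linear0 normr0 -(scale0r (0 : H2)) innerZl.
  rewrite mul0r expr0n /= !mulr0 !addr0 !div1r addrC.
  by rewrite (distrC xs) (distrC ys).
have KE := (linearD K, linearN K, linearZ_LR K).
have V_step k : V k.+1 <= alpha * V k.
  have [h_prox _ g_prox _] := gen k.
  have h_y := prox_subdiff h_proper sigma_gt0 h_sc.1 h_prox.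
  have g_x := prox_subdiff g_proper tau_gt0 g_sc.1 g_prox.
  have := strongly_convex_monotone g_proper g_sc g_x g_xs.
  have := strongly_convex_monotone h_proper h_sc h_y h_ys.
  rewrite xbarE ybarE => h_mono g_mono.
  have xiE : x k.+1 - x k = (x k.+1 - xs) - (x k - xs).
    by rewrite opprB addrA subrK.
  rewrite /V [x k.+1 - x _]xiE.
  apply: (lyapunov_step Kcont tau_gt0 sigma_gt0 alpha_gt0 alpha_lb mu_gt0
    nu_gt0 alpha_lb' beta_ub).
    move: h_mono; rewrite distrC -[_ *: K _ + y k - _]addrA scalerDr scalerA.
    rewrite mulVf ?gt_eqF // scale1r !KE !innerE.
    lra.
  move: g_mono; rewrite distrC -[- _ + x k - _]addrA scalerDr scalerN scalerA.
  rewrite mulVf ?gt_eqF // scale1r !innerE.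
  rewrite !(innerC (Ks _)) -!KsK !KE !innerE.
  lra.
have V_le k : V k <= alpha ^+ k * D.
  elim: k => [|k IH]; first by rewrite expr0 mul1r V0.
  by rewrite exprS -mulrA (le_trans (V_step k)) // ler_pM2l.
set c := 1 / sigma - alpha * eta4 * opnorm K ^+ 2.
have c_gt0 : 0 < c.
  have -> : c = (1 - alpha * sigma * eta4 * opnorm K ^+ 2) / sigma.
    by rewrite /c; field; rewrite gt_eqF.
  by rewrite divr_gt0 // subr_gt0.
(* As [tau <= eta4], replacing [tau] by [eta4] only lowers the coefficient in [lyapunov_ge]. *)
have V_ge k : c * `|y k - ys| ^+ 2 + tau^-1 * `|x k - xs| ^+ 2 <= V k.
  have lower := lyapunov_ge Kcont sigma tau_gt0 alpha_gt0
    (x k - x k.-1) (x k - xs) (y k - ys).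
  apply: (le_trans _ lower).
  rewrite lerD2r ler_wpM2r ?sqr_ge0 // /c div1r lerD2l lerN2.
  by rewrite ler_wpM2r ?sqr_ge0 // ler_pM2l.
have x_le k : `|x k - xs| ^+ 2 <= alpha ^+ k * tau * D.
  rewrite mulrAC mulrC -ler_pdivrMl //.
  apply: (le_trans _ (V_le k)); apply: (le_trans _ (V_ge k)).
  by rewrite lerDr mulr_ge0 ?sqr_ge0 // ltW.
have y_le k : `|y k - ys| ^+ 2 <= alpha ^+ k / c * D.
  rewrite mulrAC mulrC ler_pdivlMl //.
  apply: (le_trans _ (V_le k)); apply: (le_trans _ (V_ge k)).
  by rewrite lerDl mulr_ge0 ?sqr_ge0 // invr_ge0 ltW.
split=> [k|]; first by split; [exact: x_le | exact: y_le].
split; first by rewrite alpha_gt0.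
  apply: cvg_pair.
    by apply: (@cvg_sqr_geometric _ _ _ _ alpha (tau * D)) => [|k];
      rewrite ?alpha_gt0 // mulrA.
  by apply: (@cvg_sqr_geometric _ _ _ _ alpha (c^-1 * D)) => [|k];
    rewrite ?alpha_gt0 // mulrA.
exists ((tau + c^-1) * D) => k.
apply: le_trans (lerD (x_le k) (y_le k)) _.
rewrite le_eqVlt; apply/orP; left; apply/eqP; ring.
Qed.
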